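(* Let $k\geq 4$ be an integer and let $\varepsilon,\delta$ be real constants with $0<\varepsilon\leq 1/2$ and $0\leq \delta<\frac{\varepsilon^3}{3k^2}$. Then for every even integer $n\geq 4$, every graph $G$ whose edges are colored with $k$ colors and which satisfies $v(G)>(k-1/2+\varepsilon)n$ and $e(G)\geq (1-\delta)\binom{v(G)}{2}$ contains a monochromatic connected matching of size $n/2$.
   Context: All graphs are finite and simple; $v(G)$ and $e(G)$ denote the numbers of vertices and edges of $G$. A $k$-coloring of $G$ assigns one of $k$ colors to each edge. A matching $M$ in a graph $H$ is connected in $H$ if all edges of $M$ lie in the same connected component of $H$; its size is its number of edges. A monochromatic connected matching of size $n/2$ is a matching of $n/2$ edges, all of one color $i$, which is connected in the subgraph $G_i$ formed by the edges of color $i$. *)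

(* Defs.v *)
From mathcomp Require Import all_boot.

Set Implicit Arguments.
Unset Strict Implicit.
Unset Printing Implicit Defensive.

Record sgraph := SGraph {
  vertex :> finType;
  adj : rel vertex;
  adj_sym : symmetric adj;
  adj_irrefl : irreflexive adj
}.

Definition edges (G : sgraph) : {set {set G}} :=
  [set [set p.1; p.2] | p : G * G & adj p.1 p.2].

(* The values of a coloring outside [edges G] are irrelevant: [color_adj]
   below only looks at the colors of edges. *)
Definition coloring (k : nat) (G : sgraph) := {set G} -> 'I_k.

Section ColorClass.
Variables (k : nat) (G : sgraph) (c : coloring k G) (i : 'I_k).

Definition color_adj : rel G := fun x y => adj x y && (c [set x; y] == i).

Fact color_adj_sym : symmetric color_adj.
Proof. by move=> x y; rewrite /color_adj adj_sym setUC. Qed.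

Fact color_adj_irrefl : irreflexive color_adj.
Proof. by move=> x; rewrite /color_adj adj_irrefl. Qed.

Definition color_class : sgraph := SGraph color_adj_sym color_adj_irrefl.

End ColorClass.

Definition matching (H : sgraph) (M : {set {set H}}) : bool :=
  (M \subset edges H) && trivIset M.

Definition component (H : sgraph) (x : H) : {set H} :=
  [set y | connect (@adj H) x y].

Definition connected_matching (H : sgraph) (M : {set {set H}}) : bool :=
  matching M && [exists x : H, [forall A in M, A \subset component x]].

Definition has_mono_connected_matching
    (k : nat) (G : sgraph) (c : coloring k G) (m : nat) : Prop :=
  exists (i : 'I_k) (M : {set {set color_class c i}}),
    connected_matching M /\ #|M| = m.

(* Main.v *)
Require Import Defs.
From HB Require Import structures.
From mathcomp Require Import all_boot all_order all_algebra.
From mathcomp Require Import reals.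
From mathcomp Require Import zify ring lra.

Set Implicit Arguments.
Unset Strict Implicit.
Unset Printing Implicit Defensive.

Import Order.TTheory GRing.Theory Num.Theory.

(** Suppose no color has a connected matching of size [n/2].  Applying the
    Tutte-Berge formula to each component of color [i] with more than [n]
    vertices yields a barrier [S_i] outside which color [i] splits into blocks
    of at most [n] vertices and all closed degrees are at most [n].  A vertex of
    nearly full degree outside all barriers therefore has closed degree above
    [n/2] in every color.  In a component with barrier of size [s], at most
    [n - 2s] vertices outside the barrier have closed degree above [n/2], and
    summing degrees over the remaining vertices shows a loss of [s n/2] against
    the value [n] per vertex.  Since [G] can only afford an average loss below
    [n/2] per vertex, the set of vertices lying in some barrier or having many
    non-neighbors is tiny.  On its complement every color is a disjoint union
    of blocks of at most [n] vertices, and Gyarfas' argument bounds the number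
    of vertices by roughly [(k-1)n]. *)

(** * Gallai's lemma and the Tutte-Berge formula *)

Section TutteBerge.
Variable H : sgraph.
Implicit Types (A D S : {set H}) (E F : {set H}) (M N : {set {set H}}).

Definition matching_in A M := matching M && (cover M \subset A).

Definition max_matching_in A M :=
  matching_in A M && [forall N, matching_in A N ==> (#|N| <= #|M|)].

Lemma edgesP E :
  reflect (exists x y, adj x y /\ E = [set x; y]) (E \in edges H).
Proof.
apply: (iffP imsetP) => [[[x y]]|[x [y [xy ->]]]].
  by rewrite inE /= => xy ->; exists x, y.
by exists (x, y); rewrite ?inE.
Qed.

Lemma adj_neq (x y : H) : adj x y -> x != y.
Proof. by apply: contraTneq => ->; rewrite adj_irrefl. Qed.

Lemma card_edge E : E \in edges H -> #|E| = 2.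
Proof. by case/edgesP=> x [y [/adj_neq xy ->]]; rewrite cards2 xy. Qed.

Lemma edge_at E x : E \in edges H -> x \in E ->
  exists2 y, adj x y & E = [set x; y].
Proof.
case/edgesP=> u [v [uv ->]]; rewrite !inE => /orP[] /eqP->; first by exists v.
by exists u; rewrite 1?adj_sym // setUC.
Qed.

Lemma max_matching_exists A : exists M, max_matching_in A M.
Proof.
have M0 : matching_in A set0.
  rewrite /matching_in /matching sub0set /cover big_set0 sub0set andbT /=.
  by apply/trivIsetP => E F; rewrite inE.
case: (@arg_maxnP _ set0 (matching_in A) (fun M => #|M|) M0) => M MA maxM.
by exists M; rewrite /max_matching_in MA; apply/forall_inP.
Qed.

Lemma card_cover_matching M : matching M -> #|cover M| = (#|M|).*2.
Proof.
case/andP=> /subsetP sME /eqP <-.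
rewrite (eq_bigr (fun=> 2)) => [|E /sME /card_edge //].
by rewrite sum_nat_const muln2.
Qed.

Lemma matching_add A M E : matching_in A M -> E \in edges H -> E \subset A ->
  [disjoint E & cover M] -> matching_in A (E |: M) /\ #|E |: M| = #|M|.+1.
Proof.
case/andP=> /andP[sME tM] sMA eE sEA dEM.
have nEM : E \notin M.
  apply/negP => EM; have := card_edge eE.
  suff -> : E = set0 by rewrite cards0.
  apply/setP=> z; rewrite inE; apply/negbTE/negP => zE.
  by have /negP[] := disjointFr dEM zE; rewrite /= ; apply/bigcupP; exists E.
split; last by rewrite cardsU1 nEM.
rewrite /matching_in /matching subUset sub1set eE sME /=.
apply/andP; split; last first.
  by apply/subsetP=> z /bigcupP[F]; rewrite !inE => /orP[/eqP->|FM] zF;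
    [exact: (subsetP sEA) | apply: (subsetP sMA); apply/bigcupP; exists F].
have dEF F : F \in M -> [disjoint E & F].
  by move=> FM; apply: disjointWr dEM; apply: bigcup_sup.
apply/trivIsetP=> F1 F2; rewrite !inE => /orP[/eqP->|F1M] /orP[/eqP->|F2M] //.
- by rewrite eqxx.
- by move=> _; apply: dEF.
- by move=> _; rewrite disjoint_sym; apply: dEF.
- exact: (trivIsetP tM).
Qed.

Lemma matching_sub A M N : N \subset M -> matching_in A M -> matching_in A N.
Proof.
move=> sNM /andP[/andP[sME tM] sMA]; apply/andP; split; [apply/andP; split|].
- exact: subset_trans sME.
- exact: trivIsetS tM.
- apply: subset_trans sMA; apply/bigcupsP=> E EN.
  by apply: bigcup_sup; apply: (subsetP sNM).
Qed.

Lemma max_matching_adj A M x y : max_matching_in A M ->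
  x \in A -> y \in A -> adj x y -> x \notin cover M -> y \in cover M.
Proof.
case/andP=> MA /forall_inP maxM xA yA xy nx; apply/negPn/negP => ny.
have [|||MA' cM] := @matching_add A M [set x; y] MA.
- by apply/edgesP; exists x, y.
- by rewrite subUset !sub1set xA yA.
- by rewrite disjoint_subset; apply/subsetP=> z; rewrite !inE => /orP[]/eqP->.
by have := maxM _ MA'; rewrite cM ltnn.
Qed.

(** The relation of Gallai's lemma. The disjunct [x == y] makes it reflexive, so that it can become
    an equivalence whose classes serve as blocks. *)
Definition never_both_missed A (x y : H) :=
  (x == y) ||
  [forall M, max_matching_in A M ==> ((x \in cover M) || (y \in cover M))].

(* Gallai's lemma: among the maximum matchings [N] missing [t], one that
   shares as many edges as possible with [M] could be improved by exchanging
   an edge if it covered both [u] and [v]. *)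
Lemma never_both_missed_trans A :
  (forall t, t \in A -> exists2 N, max_matching_in A N & t \notin cover N) ->
  forall u t v, t \in A -> never_both_missed A u t ->
  never_both_missed A t v -> never_both_missed A u v.
Proof.
move=> missed u t v tA /orP[/eqP-> //|ut] /orP[/eqP<-|tv].
  by apply/orP; right.
apply/orP; have [->|nuv] := eqVneq u v; [by left | right].
apply/forall_inP=> M maxM; apply/negPn/negP; rewrite negb_or => /andP[nu nv].
have [N0 maxN0 tN0] := missed t tA.
have P0 : max_matching_in A N0 && (t \notin cover N0) by rewrite maxN0.
case: (@arg_maxnP _ N0 (fun N => max_matching_in A N && (t \notin cover N))
  (fun N => #|M :&: N|) P0) => N /andP[maxN tN] bestN.
have uN : u \in cover N.
  by have := forall_inP ut N maxN; rewrite (negbTE tN) orbF.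
have vN : v \in cover N by have := forall_inP tv N maxN; rewrite (negbTE tN).
have [/andP[MA /forall_inP leM] /andP[NA /forall_inP leN]] := (maxM, maxN).
have [/andP[mM _] /andP[mN sNA]] := (MA, NA).
have eMN : #|cover M| = #|cover N|.
  rewrite !card_cover_matching //; congr _.*2; apply/eqP.
  by rewrite eqn_leq leM // leN.
(* [M] and [N] cover equally many vertices, and [N] covers [u] and [v], which [M] misses. Hence [M]
   covers two vertices missed by [N], and one of them, [x], differs from [t]. *)
have : 1 < #|cover M :\: cover N|.
  rewrite cardsD eMN setIC -cardsD.
  have <- : #|[set u; v]| = 2 by rewrite cards2 nuv.
  by apply: subset_leq_card; rewrite subUset !sub1set !inE nu nv uN vN.
move=> gt1; have [x] : exists x, x \in (cover M :\: cover N) :\ t.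
  apply/set0Pn; rewrite -card_gt0 -ltnS; apply: leq_trans gt1 _.
  by rewrite (cardsD1 t) -[in leqRHS]add1n leq_add2r leq_b1.
rewrite !inE => /and3P[xt xN /bigcupP[E EM xE]].
have [/andP[sME tM] /andP[sNE tNI]] := (mM, mN).
have eE := subsetP sME _ EM.
have [y xy defE] := edge_at eE xE.
have sEA : E \subset A.
  by case/andP: MA => _ sMA; apply: subset_trans sMA; apply: bigcup_sup.
have yE : y \in E by rewrite defE !inE eqxx orbT.
have yN : y \in cover N.
  by apply: (max_matching_adj maxN _ _ xy) => //; apply: (subsetP sEA).
have /bigcupP[F FN yF] := yN.
have nFM : F \notin M.
  apply/negP=> FM; have xF : x \in F.
    by rewrite -(def_pblock tM FM yF) (def_pblock tM EM yE).
  by case/negP: xN; apply/bigcupP; exists F.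
(* Exchange: [E] replaces [F], the edge of [N] at the [M]-partner [y] of [x]. The size is kept, [t]
   stays missed, and the overlap with [M] grows because [F] is not in [M], against the choice of
   [N]. *)
have [||NA' cN'] := @matching_add A (N :\ F) E _ eE sEA.
- by apply: matching_sub NA; apply: subD1set.
- rewrite disjoint_subset; apply/subsetP=> z; rewrite defE !inE.
  case/orP=> /eqP->; apply/negP=> /bigcupP[F'];
    rewrite !inE => /andP[nF F'N] zF'.
    by case/negP: xN; apply/bigcupP; exists F'.
  by case/eqP: nF; rewrite -(def_pblock tNI FN yF) (def_pblock tNI F'N zF').
have eN : #|E |: N :\ F| = #|N| by rewrite cN' (cardsD1 F N) FN.
have nEN : E \notin N.
  by apply: contra xN => EN; apply/bigcupP; exists E.
suff /bestN : max_matching_in A (E |: N :\ F) && (t \notin cover (E |: N :\ F)).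
  apply/negP; rewrite -ltnNge.
  apply: proper_card; apply/properP; split; last first.
    by exists E; rewrite !inE ?EM ?eqxx //= negb_and nEN.
  apply/subsetP=> F'; rewrite !inE => /andP[F'M F'N].
  rewrite F'M F'N andbT /=; apply/orP; right.
  by apply: contraNneq nFM => <-.
rewrite /max_matching_in NA' eN; apply/andP; split.
  by apply/forall_inP.
apply/negP=> /bigcupP[F']; rewrite !inE => /orP[/eqP->|/andP[_ F'N]] tF'.
  move: tF'; rewrite defE !inE (eq_sym t x) (negbTE xt) /= => /eqP ty.
  by rewrite ty yN in tN.
by case/negP: tN; apply/bigcupP; exists F'.
Qed.

(** Induction on [#|A|]. A vertex covered by every maximum matching is moved into [S]. When there is
    none, Gallai's lemma makes [never_both_missed] an equivalence, and its classes are the blocks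
    for empty [S]. *)
Theorem tutte_berge A : exists S (P : {set {set H}}) M,
  [/\ S \subset A, partition P (A :\: S),
      forall D x y, D \in P -> x \in D -> y \in A :\: S -> adj x y -> y \in D,
      matching_in A M & #|S| + \sum_(D in P) #|D|./2 <= #|M|].
Proof.
have [m] := ubnP #|A|; elim: m A => // m IHm A /ltnSE leAm.
have [/exists_inP[v vA /forall_inP covv]|] :=
    boolP [exists v in A, forall M, max_matching_in A M ==> (v \in cover M)].
  have [|S [P [M [sSA partP crossP MA leM]]]] := IHm (A :\ v).
    by rewrite (cardsD1 v A) vA in leAm.
  have eAS : (A :\ v) :\: S = A :\: (v |: S) by rewrite setDDl.
  have [M' maxM'] := max_matching_exists A.
  have nvS : v \notin S by apply/negP=> /(subsetP sSA); rewrite !inE eqxx.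
  exists (v |: S), P, M'; split.
  - by rewrite subUset sub1set vA (subset_trans sSA) ?subD1set.
  - by rewrite -eAS.
  - by rewrite -eAS.
  - by case/andP: maxM'.
  (* If [M], which avoids [v], were as large as [M'], it would be a maximum matching of [A] missing
     [v]. The edge gained pays for adding [v] to the barrier. *)
  - suff : #|M| < #|M'| by rewrite cardsU1 nvS; lia.
    case/andP: MA => mM sMA; have /forall_inP leM' := (andP maxM').2.
    have MA : matching_in A M.
      by rewrite /matching_in mM (subset_trans sMA) ?subD1set.
    rewrite ltn_neqAle leM' // andbT; apply/eqP=> eM.
    have /covv : max_matching_in A M.
      by rewrite /max_matching_in MA eM; apply/forall_inP.
    by move/(subsetP sMA); rewrite !inE eqxx.
rewrite negb_exists_in => /forall_inP noc.
have missed t : t \in A -> exists2 N, max_matching_in A N & t \notin cover N.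
  by move/noc; rewrite negb_forall_in => /exists_inP.
have nsym x y : never_both_missed A x y = never_both_missed A y x.
  rewrite /never_both_missed eq_sym; congr orb; apply: eq_forallb => M.
  by rewrite orbC.
have eqv : {in A & &, equivalence_rel (never_both_missed A)}.
  move=> x y z xA yA zA; split; first by rewrite /never_both_missed eqxx.
  move=> xy; apply/idP/idP => Q.
    by apply: (never_both_missed_trans missed xA) Q; rewrite nsym.
  exact: (never_both_missed_trans missed yA) Q.
have [M maxM] := max_matching_exists A.
have partP := equivalence_partitionP eqv.
set P := equivalence_partition _ _ in partP.
have tP : trivIset P by case/and3P: partP.
have cP : cover P = A by case/and3P: partP => /eqP.
have inP D x y : D \in P -> x \in D -> y \in A ->
    (y \in D) = never_both_missed A x y.
  move=> DP xD yA; have xA : x \in A by rewrite -cP; apply/bigcupP; exists D.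
  by rewrite -(pblock_equivalence_partition eqv xA yA) (def_pblock tP DP xD).
have cross D x y : D \in P -> x \in D -> y \in A -> adj x y -> y \in D.
  move=> DP xD yA xy; have xA : x \in A by rewrite -cP; apply/bigcupP; exists D.
  rewrite (inP D x) //; apply/orP; right; apply/forall_inP => N maxN.
  by apply/orP; have [|nx] := boolP (x \in cover N); [left | right];
    last exact: max_matching_adj maxN xA yA xy nx.
exists set0, P, M; rewrite sub0set setD0; split => //; first by case/andP: maxM.
rewrite cards0 add0n.
have /andP[/andP[/andP[sME tM] sMA] _] := maxM.
(* Edges of [M] meeting [D] stay inside [D] by [cross], and [M] misses at most one vertex of [D],
   since two missed vertices of one class must coincide. *)
have half D : D \in P -> #|D|./2 <= \sum_(E in M) (E \subset D).
  move=> DP; pose MD := [set E in M | E \subset D].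
  have mMD : matching MD.
    by apply/andP; split; [apply: subset_trans sME | apply: trivIsetS tM];
      apply/subsetP=> E; rewrite inE => /andP[].
  have -> : \sum_(E in M) (E \subset D) = #|MD|.
    rewrite -sum1_card [RHS](eq_bigl (fun E => (E \in M) && (E \subset D))).
      by rewrite big_mkcondr; apply: eq_bigr => E _; case: (E \subset D).
    by move=> E; rewrite inE.
  have : #|D :\: cover MD| <= 1.
    apply/card_le1_eqP=> x y; rewrite !in_setD => /andP[nx xD] /andP[ny yD].
    have miss z : z \in D -> z \notin cover MD -> z \notin cover M.
      move=> zD; apply: contra => /bigcupP[E EM zE].
      apply/bigcupP; exists E => //.
      rewrite inE EM; have eE := subsetP sME _ EM.
      have sEA : E \subset A by apply: subset_trans sMA; apply: bigcup_sup.
      have [z' zz' defE] := edge_at eE zE.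
      rewrite defE subUset !sub1set zD (cross D z) //.
      by apply: (subsetP sEA); rewrite defE !inE eqxx orbT.
    have yA : y \in A by rewrite -cP; apply/bigcupP; exists D.
    have := yD; rewrite (inP D x) // => /orP[|/forall_inP/(_ M maxM)].
      by move/eqP.
    by rewrite (negbTE (miss _ xD nx)) (negbTE (miss _ yD ny)).
  have sub : cover MD \subset D.
    by apply/bigcupsP=> E; rewrite inE => /andP[].
  rewrite -[#|D|](cardsID (cover MD) D) (setIidPr sub).
  rewrite card_cover_matching //.
  by case: #|_ :\: _| => [|[|//]] _;
    rewrite ?addn0 ?addn1 /= ?doubleK ?uphalf_double.
apply: (@leq_trans (\sum_(D in P) \sum_(E in M) (E \subset D))).
  exact: leq_sum.
rewrite exchange_big /= -sum1_card.
apply: leq_sum => E EM; have /edgesP[x [y [_ defE]]] := subsetP sME _ EM.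
have xE : x \in E by rewrite defE !inE eqxx.
rewrite -big_mkcondr /= sum1_card; apply/card_le1_eqP => D1 D2.
move=> /andP[D1P /subsetP/(_ x xE) xD1] /andP[D2P /subsetP/(_ x xE) xD2].
by rewrite -(def_pblock tP D1P xD1) (def_pblock tP D2P xD2).
Qed.

End TutteBerge.

Lemma exists_subset_card (T : finType) (A : {set T}) (m : nat) :
  m <= #|A| -> exists2 B : {set T}, B \subset A & #|B| = m.
Proof.
move=> leA; exists [set x in take m (enum A)].
  by apply/subsetP=> x; rewrite inE => /mem_take; rewrite mem_enum.
rewrite cardsE; have /card_uniqP -> : uniq (take m (enum A)).
  by rewrite take_uniq ?enum_uniq.
by rewrite size_takel // -cardE.
Qed.

Lemma sum_leq_card (T : finType) (A : {set T}) (f : T -> nat) (b : nat) :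
  {in A, forall x, f x <= b} -> \sum_(x in A) f x <= #|A| * b.
Proof. by move=> le_f; rewrite -sum_nat_const; apply: leq_sum. Qed.

(** * Barriers and blocks in a single color *)

Section ColorStructure.
Variable H : sgraph.
Implicit Types (x y : H) (A D S W : {set H}).

Definition closed_degree x := #|[set y | adj x y]|.+1.

Lemma closed_degree_leq x A :
  x \in A -> (forall y, adj x y -> y \in A) -> closed_degree x <= #|A|.
Proof.
move=> xA nA; rewrite (cardsD1 x) xA ltnS; apply: subset_leq_card.
apply/subsetP=> y; rewrite !inE => xy.
by rewrite nA // eq_sym adj_neq.
Qed.

(** A matching with at least [h] edges would contain one with exactly [h], still inside the
    component. *)
Lemma matching_in_component_lt (h : nat) x M :
  ~ (exists N : {set {set H}}, connected_matching N /\ #|N| = h) ->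
  matching_in (component x) M -> #|M| < h.
Proof.
move=> nomatch MA; rewrite ltnNge; apply/negP=> /exists_subset_card[N sNM cN].
apply: nomatch; exists N; split => //; have /andP[mN sN] := matching_sub sNM MA.
rewrite /connected_matching mN; apply/existsP; exists x.
apply/forall_inP => E EN.
by apply: subset_trans sN; apply: bigcup_sup.
Qed.

(* [S] is the Tutte-Berge barrier and [l] the partition of its complement.
   At most one block can contain vertices of closed degree above [h], which is
   what makes the last inequality hold. *)
Lemma closed_set_structure (h : nat) A :
  (forall x y, x \in A -> adj x y -> y \in A) ->
  (forall M, matching_in A M -> #|M| < h) ->
  exists S (l : H -> {set H}),
  [/\ S \subset A,
      forall x, x \in A :\: S ->
        [/\ x \in l x, #|l x| <= h.*2 & closed_degree x <= h.*2],
      forall x y, x \in A :\: S -> y \in A :\: S -> adj x y -> l x = l y &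
      forall W, W \subset A :\: S -> {in W, forall x, h < closed_degree x} ->
        h * #|S| + \sum_(x in A :\: W) closed_degree x <= h.*2 * #|A :\: W|].
Proof.
move=> closedA small.
have [leA|gtA] := leqP #|A| h.*2.
  have le_c x : x \in A -> closed_degree x <= h.*2.
    move=> xA; apply: leq_trans leA; apply: closed_degree_leq => // y.
    exact: closedA.
  exists set0, (fun=> A); split => //.
  - exact: sub0set.
  - by move=> x; rewrite setD0 => xA; split => //; apply: le_c.
  - move=> W _ _; rewrite cards0 muln0 add0n mulnC; apply: sum_leq_card => x.
    by rewrite inE => /andP[_ /le_c].
have [S [P [M [sSA partP crossP /small ltM leM]]]] := tutte_berge A.
have tP : trivIset P by case/and3P: partP.
have cP : cover P = A :\: S by case/and3P: partP => /eqP.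
have blockP x : x \in A :\: S -> pblock P x \in P.
  by rewrite -cP; apply: pblock_mem.
have inP x : x \in A :\: S -> x \in pblock P x by rewrite -cP mem_pblock.
have le_c x : x \in A :\: S -> closed_degree x <= #|S| + #|pblock P x|.
  move=> xAS; apply: leq_trans (leq_card_setU _ _); apply: closed_degree_leq.
    by rewrite inE inP ?orbT.
  have xA : x \in A by case/setDP: xAS.
  move=> y xy; rewrite inE; case: (boolP (y \in S)) => //= yS.
  apply: (crossP _ x) => //; [exact: blockP | exact: inP |].
  by rewrite inE yS (closedA _ _ xA xy).
(* Strictness of [#|M| < h] absorbs the vertex possibly lost in [#|D|./2]. *)
have lt_block D : D \in P -> (#|S|).*2 + #|D| < h.*2.
  move=> DP; move: leM; rewrite (bigD1 D) //= => leM.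
  have := odd_double_half #|D|; move: leM ltM.
  move: #|S| #|D| #|M| (\sum_(_ | _) _) => s d m r; clear; lia.
have lt_blocks D1 D2 : D1 \in P -> D2 \in P -> D1 != D2 ->
    #|S| + #|D1|./2 + #|D2|./2 < h.
  move=> D1P D2P nD; move: leM ltM.
  rewrite (bigD1 D1) //= (bigD1 D2) ?D2P 1?eq_sym //=.
  move: #|S| #|M| (\sum_(_ | _) _) => s m r; clear; lia.
pose K := [set x in A :\: S | h < closed_degree x].
(* Vertices of [K] in two distinct blocks would make both blocks larger than [h - #|S|], against
   [lt_blocks]. So a nonempty [K] lies in one block, and [lt_block] applies. *)
have leK : #|K| + (#|S|).*2 <= h.*2.
  have [->|[x]] := set_0Vmem K.
    by rewrite cards0 leq_double; move: leM ltM; lia.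
  rewrite inE => /andP[xAS hx].
  suff /subset_leq_card leKD : K \subset pblock P x.
    rewrite addnC ltnW //; apply: leq_ltn_trans (lt_block _ (blockP _ xAS)).
    by rewrite leq_add2l.
  apply/subsetP=> y; rewrite inE => /andP[yAS hy].
  have [->|nD] := eqVneq (pblock P x) (pblock P y); first exact: inP.
  have := lt_blocks _ _ (blockP _ xAS) (blockP _ yAS) nD.
  have := leq_trans hx (le_c _ xAS); have := leq_trans hy (le_c _ yAS).
  move: #|S| #|pblock P x| #|pblock P y| => s d d'; clear; lia.
exists S, (pblock P); split => //.
- move=> x xAS; have := lt_block _ (blockP _ xAS); have := le_c _ xAS.
  rewrite inP //; move: #|S| #|pblock P x| (closed_degree x) => s d c; clear.
  by move=> ? ?; split => //; lia.
- move=> x y xAS yAS xy; apply/esym/def_pblock => //; first exact: blockP.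
  by apply: (crossP _ x) => //; [exact: blockP | exact: inP].
move=> W sW hW; set X := A :\: W.
have sWK : W \subset K.
  by apply/subsetP=> x xW; rewrite inE hW // (subsetP sW).
have XS : X :&: S = S.
  apply/setIidPr/subsetP=> x xS; rewrite inE (subsetP sSA) // andbT.
  by apply/negP=> /(subsetP sW); rewrite inE xS.
have XK : (X :\: S) :\: K = (A :\: S) :\: K.
  apply/setP=> x; rewrite !in_setD; case: (boolP (x \in K)) => //= xK.
  by have -> : x \notin W by apply: contra xK; apply: (subsetP sWK).
have KAS : (A :\: S) :&: K = K.
  by apply/setIidPr/subsetP=> x; rewrite inE => /andP[].
have eA : #|A| = #|S| + (#|K| + #|(A :\: S) :\: K|).
  by rewrite -(cardsID S A) (setIidPr sSA) -[#|A :\: S|](cardsID K) KAS.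
have eX : #|X| = #|S| + (#|(X :\: S) :&: K| + #|(A :\: S) :\: K|).
  by rewrite -(cardsID S X) XS -[#|X :\: S|](cardsID K) XK.
have le1 : \sum_(x in S) closed_degree x <= #|S| * #|A|.
  apply: sum_leq_card => x /(subsetP sSA) xA; apply: closed_degree_leq => // y.
  exact: closedA.
have le2 : \sum_(x in (X :\: S) :&: K) closed_degree x <=
    #|(X :\: S) :&: K| * h.*2.
  apply: sum_leq_card => x /setIP[_]; rewrite inE => /andP[xAS _].
  have := lt_block _ (blockP _ xAS); have := le_c _ xAS.
  move: #|S| #|pblock P x| (closed_degree x) => s d c; clear; lia.
have le3 : \sum_(x in (A :\: S) :\: K) closed_degree x <=
    #|(A :\: S) :\: K| * h.
  by apply: sum_leq_card => x /setDP[xAS]; rewrite inE xAS /= -leqNgt.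
(* Write [s] for [#|S|] and [b] for the number of vertices outside [S] and [K]. By [leK], the claim
   reduces to [0 <= (h - s) * (b - s)]; here [s <= b] follows from [leK] and [#|A| > h.*2]. *)
rewrite (big_setID S) XS /= [\sum_(x in X :\: S) _](big_setID K) XK /= eX.
move: le1 le2 le3 leK gtA; rewrite eA.
move: #|S| #|K| #|_ :&: K| #|_ :\: K| (\sum_(_ in S) _) (\sum_(_ in _ :&: K) _)
  (\sum_(_ in _ :\: K) _) => s k t b s1 s2 s3; clear; nia.
Qed.

Lemma component_closed z x y :
  x \in component z -> adj x y -> y \in component z.
Proof. by rewrite !inE => zx xy; apply: connect_trans zx (connect1 xy). Qed.

Lemma component_eq x y : y \in component x -> component y = component x.
Proof.
have sym : connect_sym (@adj H) by apply: sym_connect_sym; apply: adj_sym.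
rewrite inE => xy; apply/setP=> z; rewrite !inE.
by rewrite (same_connect sym xy).
Qed.

Lemma component_id x : x \in component x.
Proof. by rewrite inE. Qed.

(** The barriers and blocks of the components are glued together. Labelling a vertex by a block that
    contains it bounds every fibre of [l] outside [S] by [h.*2]. *)
Lemma graph_structure (h : nat) :
  ~ (exists M : {set {set H}}, connected_matching M /\ #|M| = h) ->
  exists S (l : H -> {set H}),
  [/\ forall x, x \notin S ->
        [/\ x \in l x, #|l x| <= h.*2 & closed_degree x <= h.*2],
      forall x y, x \notin S -> y \notin S -> adj x y -> l x = l y &
      forall W, [disjoint W & S] -> {in W, forall x, h < closed_degree x} ->
        h * #|S| + \sum_(x in ~: W) closed_degree x <= h.*2 * #|~: W|].
Proof.
move=> nomatch.
(* The choice is indexed by the set [A] and not by a vertex [z], so all vertices of a component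
   share one barrier and one labelling. Sets that are not components get dummy values. *)
have /fin_all_exists[S /fin_all_exists[l struct]] :
    forall A, exists S (l : H -> {set H}),
    forall z, component z = A ->
  [/\ S \subset A,
      forall x, x \in A :\: S ->
        [/\ x \in l x, #|l x| <= h.*2 & closed_degree x <= h.*2],
      forall x y, x \in A :\: S -> y \in A :\: S -> adj x y -> l x = l y &
      forall W, W \subset A :\: S -> {in W, forall x, h < closed_degree x} ->
        h * #|S| + \sum_(x in A :\: W) closed_degree x <= h.*2 * #|A :\: W|].
  move=> A; have [/existsP[z /eqP <-]|/existsPn noz] :=
      boolP [exists z, component z == A].
    have [|M|S [l sl]] := @closed_set_structure h (component z).
    - exact: component_closed.
    - exact: matching_in_component_lt.
    by exists S, l.
  by exists set0, (fun=> set0) => z zA; case/negP: (noz z); apply/eqP.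
pose S' := [set x | x \in S (component x)].
have inD x : x \notin S' -> x \in component x :\: S (component x).
  by rewrite inE => nx; rewrite in_setD nx component_id.
exists S', (fun x => l (component x) x); split.
- by move=> x /inD xD; case: (struct _ x (erefl _)) => _ /(_ x xD).
- move=> x y /inD xD /inD yD xy.
  have yx : component y = component x.
    by apply: component_eq; apply: component_closed xy; apply: component_id.
  case: (struct _ x (erefl _)) => _ _ Q _; rewrite yx; apply: Q => //.
  by rewrite -yx.
move=> W dW hW.
(* Both sides are additive over components, so the bound is applied to [W :&: A] in each component
   [A]. *)
rewrite -!sum1_card !(partition_big (@component H) predT) //= !big_distrr /=.
rewrite -big_split /=; apply: leq_sum => A _.
have [/existsP[z /eqP zA]|/existsPn noz] := boolP [exists z, component z == A];
    last first.
  by rewrite !big1 ?muln0 // => x /andP[_ /idPn]; case; apply: noz.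
have inA x : (component x == A) = (x \in A).
  rewrite -zA; apply/eqP/idP; last exact: component_eq.
  by move=> <-; apply: component_id.
have [sSA _ _ /(_ (W :&: A))] := struct A z zA.
have -> : A :\: (W :&: A) = A :\: W.
  by apply/setP=> x; rewrite !inE; case: (x \in A); rewrite ?andbF ?andbT.
have eqS : #|S A| = \sum_(x in S' | component x == A) 1.
  rewrite -sum1_card; apply: eq_bigl => x; rewrite inE inA.
  apply/idP/andP=> [xS|[xS xA]].
    have xA := subsetP sSA _ xS; split => //.
    by have /eqP -> : component x == A by rewrite inA.
  by move: xS; have /eqP -> : component x == A by rewrite inA.
have eqD x : (x \in A :\: W) = (x \in ~: W) && (component x == A).
  by rewrite !inE inA.
rewrite eqS (eq_bigl _ _ eqD) -sum1_card (eq_bigl _ _ eqD); apply; last first.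
  by move=> x /setIP[xW _]; apply: hW.
apply/subsetP=> x /setIP[xW xA]; rewrite inE xA andbT.
have := disjointFr dW xW; rewrite inE.
by have /eqP -> : component x == A by [rewrite inA]; move->.
Qed.

End ColorStructure.

(** * Gyarfas' argument on covering pairs by partitions *)

Section PartitionCover.
Variables (T L : finType).
Implicit Types (W X : {set T}) (l : T -> L).

(** Take a largest union of blocks that fills at most half of [W]. Adding one more block exceeds
    half, so the complement of the enlarged union fills less than half and, by maximality, is no
    larger than the chosen union. *)
Lemma balanced_union_of_blocks (b : nat) W l :
  (forall a, #|[set x in W | l x == a]| <= b) ->
  exists X, [/\ X \subset W,
    forall x y, x \in X -> y \in W -> l x = l y -> y \in X &
    (#|X|).*2 <= #|W| <= (#|X|).*2 + b].
Proof.
move=> leb; pose U (B : {set L}) := [set x in W | l x \in B].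
have U0 : (#|U set0|).*2 <= #|W|.
  by rewrite (_ : U set0 = set0) ?cards0 //; apply/setP=> x; rewrite !inE andbF.
case: (@arg_maxnP _ set0 (fun B => (#|U B|).*2 <= #|W|) (fun B => #|U B|) U0).
move=> B leB maxB; exists (U B); split.
- by apply/subsetP=> x; rewrite inE => /andP[].
- by move=> x y; rewrite !inE => /andP[_ xB] -> <-.
rewrite leB /=; have [W0|[y]] := set_0Vmem (W :\: U B).
  have /subset_leq_card : W \subset U B by rewrite -setD_eq0 W0.
  move: #|W| #|U B| => w u; clear; lia.
rewrite !inE => /andP[yB yW].
have gtB : #|W| < (#|U (l y |: B)|).*2.
  rewrite ltnNge; apply/negP=> /maxB; apply/negP; rewrite -ltnNge.
  apply: proper_card; apply/properP; split.
    by apply/subsetP=> x; rewrite !inE => /andP[-> ->]; rewrite orbT.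
  by exists y; rewrite !inE yW ?eqxx //= in yB *.
have leU : #|U (l y |: B)| <= #|U B| + b.
  apply: leq_trans (leq_add (leqnn _) (leb (l y))).
  apply: leq_trans (leq_card_setU _ _); apply: subset_leq_card.
  by apply/subsetP=> x; rewrite !inE => /andP[-> /orP[]->]; rewrite ?orbT.
have eU : #|U (l y |: B)| + #|U (~: (l y |: B))| = #|W|.
  rewrite -(cardsID (U (l y |: B)) W); congr (_ + _); apply: eq_card => x;
    by rewrite !inE; case: (x \in W); rewrite ?andbF ?andbT.
have := maxB (~: (l y |: B)); move: gtB leU; rewrite -eU.
move: #|U (l y |: B)| #|U (~: _)| #|U B| => u u' u0 => ? ? Q.
suff : u' <= u0 by lia.
apply: Q; lia.
Qed.

(** A block split into parts of sizes [u] and [v] contributes [u * v] pairs, and [4 * (u * v) <= (u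
    + v) ^ 2 <= b * (u + v)]. *)
Lemma cross_pairs_bound (b : nat) W X l :
  (forall a, #|[set x in W | l x == a]| <= b) -> X \subset W ->
  4 * (\sum_(x in X) \sum_(y in W :\: X) (l x == l y)) <= b * #|W|.
Proof.
move=> leb sXW.
pose p (Y : {set T}) a := #|[set x in Y | l x == a]|.
have sum_p Y : \sum_a p Y a = #|Y|.
  rewrite -sum1_card (partition_big l predT) //=; apply: eq_bigr => a _.
  by rewrite /p -sum1_card; apply: eq_bigl => x; rewrite inE.
have -> : \sum_(x in X) \sum_(y in W :\: X) (l x == l y) =
    \sum_a p X a * p (W :\: X) a.
  rewrite (partition_big l predT) //=; apply: eq_bigr => a _.
  rewrite (eq_bigr (fun=> p (W :\: X) a)) => [|x /andP[_ /eqP ->]].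
    by rewrite sum_nat_const; congr (_ * _); apply: eq_card => x; rewrite inE.
  rewrite /p -sum1_card big_mkcond [RHS]big_mkcond; apply: eq_bigr => y _.
  by rewrite inE eq_sym; case: (y \in _); case: (_ == _).
have -> : #|W| = #|X| + #|W :\: X| by rewrite -(cardsID X) (setIidPr sXW).
rewrite -!sum_p -big_split !big_distrr /=; apply: leq_sum => a _.
have : p X a + p (W :\: X) a <= b.
  apply: leq_trans (leb a); rewrite -(cardsID X); apply: leq_add;
    apply: subset_leq_card; apply/subsetP=> x; rewrite !inE => /andP[].
    by move=> xX ->; rewrite xX (subsetP sXW).
  by move=> /andP[-> ->] ->.
move: (p X a) (p (W :\: X) a) => u v le_uv.
apply: leq_trans (leq_mul le_uv (leqnn (u + v))).
by rewrite mulnn nat_AGM2.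
Qed.

(* Gyarfas' argument: split [W] into two parts made of blocks of one of the
   partitions; the pairs across must be covered by the [k - 1] others. *)
Lemma partition_cover_bound (k b : nat) W (l : 'I_k -> T -> L) (i0 : 'I_k) :
  (forall i a, #|[set x in W | l i x == a]| <= b) ->
  #|W| ^ 2 <= b ^ 2 + k.-1 * b * #|W| +
    4 * #|[set p in setX W W | [forall i, l i p.1 != l i p.2]]|.
Proof.
move=> leb; have [X [sXW closedX sizeX]] := balanced_union_of_blocks (leb i0).
set mis := [set p in _ | _].
pose cross i := \sum_(x in X) \sum_(y in W :\: X) (l i x == l i y).
have le_cross : #|X| * #|W :\: X| <= \sum_(i | i != i0) cross i + #|mis|.
  have -> : #|X| * #|W :\: X| = \sum_(x in X) \sum_(y in W :\: X) 1.
    by rewrite !sum_nat_const muln1.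
  have le_mis : \sum_(x in X) \sum_(y in W :\: X) [forall i, l i x != l i y]
      <= #|mis|.
    rewrite pair_big /= -sum1_card big_mkcond [leqRHS]big_mkcond /=.
    apply: leq_sum => -[x y] _; rewrite /mis !inE /=.
    case: (boolP (x \in X)) => //= xX; rewrite (subsetP sXW x xX) /=.
    by case: (y \in X) => //=; case: (y \in W) => //=; case: [forall _, _].
  have -> : \sum_(i | i != i0) cross i =
      \sum_(x in X) \sum_(y in W :\: X) \sum_(i | i != i0) (l i x == l i y).
    by rewrite exchange_big; apply: eq_bigr => x _; rewrite exchange_big.
  apply: leq_trans (leq_add (leqnn _) le_mis); rewrite -big_split /=.
  apply: leq_sum => x xX; rewrite -big_split /=.
  apply: leq_sum => y /setDP[yW yX].
  (* A pair not separated by all partitions agrees in some [i], and [i] is not [i0] because [X] is a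
     union of blocks of [l i0]. *)
  have [|/forallPn[i]] := boolP [forall i, l i x != l i y].
    by rewrite addn1.
  rewrite negbK => lxy; rewrite addn0 (bigD1 i) ?lxy //=.
  apply: contraNneq yX => ii0; rewrite -ii0 in closedX.
  exact: closedX (eqP lxy).
have le_k : 4 * \sum_(i | i != i0) cross i <= k.-1 * b * #|W|.
  rewrite big_distrr /= -mulnA.
  have ek : k.-1 = #|[pred i : 'I_k | i != i0]| by rewrite cardC1 card_ord.
  rewrite [in leqRHS]ek -sum_nat_const; apply: leq_sum => i _.
  exact: cross_pairs_bound.
move: le_cross le_k sizeX; rewrite -[#|W|](cardsID X) (setIidPr sXW).
move: #|X| #|W :\: X| #|mis| (\sum_(i | _) _)
  => u v m s => le1 le2 /andP[leu lev].
(* The square of [#|W|] is [4 * (u * v) + d ^ 2], and the imbalance [d] is at most [b]; this is the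
   source of the term [b ^ 2]. *)
have [d defv] : exists d, v = u + d by exists (v - u); lia.
have led : d <= b by lia.
rewrite {v}defv in le1 le2 leu lev *.
have -> : (u + (u + d)) ^ 2 = 4 * (u * (u + d)) + d ^ 2 by rewrite -!mulnn; lia.
have : d ^ 2 <= b ^ 2 by rewrite leq_sqr.
lia.
Qed.
End PartitionCover.

(** * Degrees and non-neighbors *)

Section Degrees.
Variable G : sgraph.

Lemma handshake_leq : (#|edges G|).*2 <= \sum_(x : G) #|[set y | adj x y]|.
Proof.
have -> : (#|edges G|).*2 = \sum_(E in edges G) #|E|.
  by rewrite (eq_bigr (fun=> 2)) ?sum_nat_const ?muln2 // => E /card_edge.
rewrite (eq_bigr (fun E : {set G} => \sum_(x : G) (x \in E))); last first.
  move=> E _; rewrite -sum1_card big_mkcond.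
  by apply: eq_bigr => x _; case: (x \in E).
rewrite exchange_big; apply: leq_sum => x _ /=.
rewrite -big_mkcondr /= sum1_card.
apply: leq_trans (leq_imset_card (fun y => [set x; y]) _).
apply: subset_leq_card; apply/subsetP=> E /andP[eE xE].
by have [y xy ->] := edge_at eE xE; apply: imset_f; rewrite inE.
Qed.

Definition codegree (x : G) := #|[set y | (y != x) && ~~ adj x y]|.

Lemma degree_codegree (x : G) :
  #|[set y | adj x y]| + codegree x + 1 = #|G|.
Proof.
rewrite -(cardC [set y | adj x y]) -addnA; congr (_ + _).
rewrite (cardD1 x) !inE adj_irrefl /= addnC; congr (_ + _).
by apply: eq_card => y; rewrite !inE.
Qed.

(** Each edge at [x] has exactly one color; the extra [k] arises because a closed degree counts [x]
    itself, once per color. *)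
Lemma sum_color_degree (k : nat) (c : coloring k G) (x : G) :
  \sum_i @closed_degree (color_class c i) x = k + #|[set y | adj x y]|.
Proof.
rewrite (eq_bigr (fun i => 1 + #|[set y | color_adj c i x y]|)) //.
rewrite big_split sum1_card card_ord /=; congr (_ + _).
rewrite -[RHS]sum1_card (partition_big (fun y => c [set x; y]) predT) //=.
apply: eq_bigr => i _; rewrite -sum1_card; apply: eq_bigl => y.
by rewrite !inE.
Qed.

End Degrees.

(** * Combining the barriers of all colors *)

Section Coloring.
Variables (k : nat) (G : sgraph) (c : coloring k G) (h : nat).

Definition color_degree (i : 'I_k) (x : G) :=
  @closed_degree (color_class c i) x.

Lemma coloring_structure : ~ has_mono_connected_matching c h ->
  exists (S : 'I_k -> {set G}) (l : 'I_k -> G -> {set G}), forall i,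
  [/\ forall x, x \notin S i ->
        [/\ x \in l i x, #|l i x| <= h.*2 & color_degree i x <= h.*2],
      forall x y, x \notin S i -> y \notin S i -> color_adj c i x y ->
        l i x = l i y &
      forall W : {set G}, [disjoint W & S i] ->
        {in W, forall x, h < color_degree i x} ->
        h * #|S i| + \sum_(x in ~: W) color_degree i x <= h.*2 * #|~: W|].
Proof.
move=> nomono.
suff /fin_all_exists[S /fin_all_exists[l Q]] : forall i : 'I_k,
  exists (S : {set G}) (l : G -> {set G}),
  [/\ forall x, x \notin S ->
        [/\ x \in l x, #|l x| <= h.*2 & color_degree i x <= h.*2],
      forall x y, x \notin S -> y \notin S -> color_adj c i x y -> l x = l y &
      forall W : {set G}, [disjoint W & S] ->
        {in W, forall x, h < color_degree i x} ->
        h * #|S| + \sum_(x in ~: W) color_degree i x <= h.*2 * #|~: W|].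
  by exists S, l.
move=> i; apply: (@graph_structure (color_class c i) h) => -[M MH].
by apply: nomono; exists i, M.
Qed.

(** Adding the bounds over all colors gives a loss of [h] times the sum of the [#|S i|]. This sum is
    at least [#|~: W| - #|B|], as the [S i] and [B] cover the complement of [W]. *)
Lemma exceptional_set_bound (S : 'I_k -> {set G}) (B W : {set G}) :
  (forall i, h * #|S i| + \sum_(x in ~: W) color_degree i x <=
    h.*2 * #|~: W|) ->
  ~: W \subset (\bigcup_i S i) :|: B ->
  h * #|~: W| + \sum_(x in ~: W) \sum_i color_degree i x <=
    h * #|B| + k * h.*2 * #|~: W|.
Proof.
move=> bound /subset_leq_card leW.
have le_U : #|\bigcup_i S i| <= \sum_i #|S i|.
  elim/big_ind2: _ => [|m A n D le1 le2|//]; first by rewrite cards0.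
  exact: leq_trans (leq_card_setU _ _) (leq_add le1 le2).
have : \sum_(i < k) (h * #|S i| + \sum_(x in ~: W) color_degree i x) <=
    \sum_(i < k) h.*2 * #|~: W| by apply: leq_sum.
rewrite big_split -big_distrr sum_nat_const card_ord exchange_big /= mulnA.
have : h * #|~: W| <= h * (\sum_i #|S i| + #|B|).
  rewrite leq_mul2l (leq_trans leW) ?orbT //.
  exact: leq_trans (leq_card_setU _ _) (leq_add le_U (leqnn _)).
rewrite mulnDr; move: (h * _) (h * _) (h * _) (k * _ * _) => a b d e.
lia.
Qed.

End Coloring.

(** * Counting non-adjacent pairs *)

Lemma codegree_sum_bound (R : realType) (G : sgraph) (delta : R) :
  ((1 - delta) * 'C(#|G|, 2)%:R <= #|edges G|%:R)%R ->
  (0 <= delta)%R ->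
  ((\sum_(x : G) codegree x)%:R <= delta * #|G|%:R ^+ 2)%R.
Proof.
move=> he d0; set N := #|G|.
have sumN : \sum_(x : G) #|[set y | adj x y]| + \sum_(x : G) codegree x + N =
    N * N.
  have <- : \sum_(x : G) N = N * N by rewrite sum_nat_const.
  rewrite -(eq_bigr _ (fun x _ => degree_codegree x)) !big_split /=.
  by rewrite sum1_card.
have hs := handshake_leq G.
have eC : 2 * 'C(N, 2) + N = N * N.
  by rewrite -mul_bin_diag bin1; case: (N) => // m; rewrite -mulnSr.
have {eC} eC : (2 * 'C(N, 2)%:R + N%:R = N%:R * N%:R :> R)%R.
  by rewrite -!natrM -natrD eC.
have N0 : (0 <= N%:R :> R)%R by [].
have le1 : (2 * #|edges G|%:R + (\sum_(x : G) codegree x)%:R + N%:R <=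
    N%:R * N%:R :> R)%R.
  rewrite -!natrM -!natrD ler_nat -sumN mul2n !leq_add2r; exact: hs.
move: he eC le1; rewrite -/N.
move: #|edges G|%:R%R ('C(N, 2))%:R%R => e C he eC le1.
have : (0 <= delta * N%:R)%R by apply: mulr_ge0.
rewrite expr2; nra.
Qed.

Lemma card_codegree_pairs (G : sgraph) :
  #|[set p : G * G | (p.2 != p.1) && ~~ adj p.1 p.2]| = \sum_(x : G) codegree x.
Proof.
under [RHS]eq_bigr do rewrite /codegree -sum1_card.
rewrite pair_big_dep /= -sum1_card; apply: eq_bigl => -[x y].
by rewrite !inE.
Qed.

(** * Real estimates for the exceptional vertices *)

Local Open Scope ring_scope.

(* In the next three lemmas, [n], [N], [z] and [b] stand for the size parameter
   and the numbers of all, exceptional and low-degree vertices, and [D] for the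
   number of ordered pairs of distinct non-adjacent vertices. *)
Lemma exceptional_numeric (R : realType) (k n N g z D eps b : R) :
  0 < eps -> eps <= 1 / 2 -> N = g + (k - 1 / 2) * n -> 0 <= D ->
  b * (eps * n) <= D ->
  n / 2 * z + (z * N - D) <= n / 2 * b + k * n * z -> eps * g * z <= D.
Proof.
move=> eps0 eps1 hN D0 hb hz.
(* Here [N + n / 2 - k * n = g]. After multiplication by [eps], each of the two terms on the right
   is at most [D / 2]. *)
have gz : g * z <= D + n / 2 * b by move: hz; rewrite hN; lra.
have : eps * (g * z) <= eps * (D + n / 2 * b) by rewrite ler_pM2l.
have : eps * D <= 1 / 2 * D by apply: ler_wpM2r.
rewrite -mulrA; nra.
Qed.

Lemma all_exceptional_false (R : realType) (k n N g D eps delta : R) :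
  4 <= k -> 0 < n -> 0 < eps -> eps <= 1 / 2 ->
  delta * (3 * k ^+ 2) < eps ^+ 3 ->
  N = g + (k - 1 / 2) * n -> eps * n < g -> D <= delta * N ^+ 2 ->
  eps * g * N <= D -> False.
Proof.
move=> k4 n0 eps0 eps1 delta1 hN hg hD hz.
have en0 : 0 < eps * n by apply: mulr_gt0.
have kn0 : 0 < k * n by apply: mulr_gt0 => //; lra.
have N0 : 0 < N by rewrite hN; apply: addr_gt0; [lra | apply: mulr_gt0; lra].
have leg : eps * g <= delta * N.
  rewrite -(ler_pM2r N0); apply: le_trans hz (le_trans hD _).
  by rewrite expr2 mulrA.
have k2 : 0 < 3 * k ^+ 2 by rewrite mulr_gt0 // exprn_gt0 //; lra.
have le1 : eps * g * (3 * k ^+ 2) <= eps ^+ 3 * N.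
  apply: (@le_trans _ _ (delta * N * (3 * k ^+ 2))); first by rewrite ler_pM2r.
  by rewrite mulrAC ler_pM2r // ltW.
(* This is contradictory: the left side is at least [12 * k * g], while [eps * n < g] bounds the
   right side by [g / 4 + k * g / 2]. *)
have le2 : 3 * k ^+ 2 * g <= eps ^+ 2 * N.
  by rewrite -(ler_pM2l eps0); move: le1; rewrite (exprS eps 2); lra.
have e2 : eps ^+ 2 <= 1 / 2 * eps by rewrite expr2 ler_pM2r.
have g0 : 0 < g by apply: lt_trans hg.
have le3 : 3 * k ^+ 2 * g <= 1 / 2 * eps * N.
  by apply: le_trans le2 _; rewrite ler_pM2r.
have le4 : 48 * g <= 3 * k ^+ 2 * g by rewrite ler_pM2r // expr2; nra.
have le5 : 12 * k * g <= 3 * k ^+ 2 * g by rewrite ler_pM2r // expr2; nra.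
have le6 : 1 / 2 * eps * N <= 1 / 4 * g + 1 / 2 * k * g.
  rewrite hN mulrDr; apply: lerD; first by rewrite ler_pM2r //; lra.
  have : k * (eps * n) <= k * g by rewrite ler_pM2l; lra.
  nra.
have : 0 < k * g by apply: mulr_gt0 => //; lra.
lra.
Qed.

Lemma few_exceptional_false (R : realType) (k n N g z D eps delta : R) :
  4 <= k -> 0 < n -> 0 < eps -> eps <= 1 / 2 -> 0 <= delta ->
  delta * (3 * k ^+ 2) < eps ^+ 3 ->
  N = g + (k - 1 / 2) * n -> eps * n < g -> 0 <= z -> D <= delta * N ^+ 2 ->
  N <= (k + 1 / 2) * n -> eps * g * z <= D ->
  (N - z) ^+ 2 <= n ^+ 2 + (k - 1) * n * (N - z) + 4 * D -> False.
Proof.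
move=> k4 n0 eps0 eps1 delta0 delta1 hN hg z0 hD leN hz hw.
have en0 : 0 < eps * n by apply: mulr_gt0.
have N0 : 0 < N by rewrite hN; apply: addr_gt0; [lra | apply: mulr_gt0; lra].
have n2 : 0 < n ^+ 2 by rewrite exprn_gt0.
(* The constant comes from [k + 1 / 2 <= 9 / 8 * k], valid for [4 <= k], since
   [(9 / 8) ^+ 2 = 3 * (27 / 64)]. *)
have hN2 : N ^+ 2 <= (3 * k ^+ 2) * (27 / 64) * n ^+ 2.
  apply: (@le_trans _ _ (((k + 1 / 2) * n) ^+ 2)).
    by rewrite ler_pXn2r // nnegrE; [exact: ltW | apply: mulr_ge0; lra].
  by rewrite exprMn ler_pM2r // !expr2; nra.
have hD2 : D <= 27 / 64 * eps ^+ 3 * n ^+ 2.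
  apply: (le_trans hD).
  apply: (@le_trans _ _ (delta * ((3 * k ^+ 2) * (27 / 64) * n ^+ 2))).
    by apply: ler_wpM2l.
  have : delta * (3 * k ^+ 2) * (27 / 64 * n ^+ 2) <=
      eps ^+ 3 * (27 / 64 * n ^+ 2).
    by rewrite ler_pM2r; [exact: ltW | apply: mulr_gt0 => //; lra].
  lra.
have hz2 : z <= 27 / 64 * (eps * n).
  have e2 : 0 < eps * (eps * n) by apply: mulr_gt0.
  rewrite -(ler_pM2l e2).
  apply: (@le_trans _ _ (eps * g * z)).
    by rewrite ler_wpM2r // ler_pM2l // ltW.
  apply: (le_trans hz); apply: (le_trans hD2).
  by rewrite le_eqVlt; apply/orP; left; apply/eqP; rewrite !exprS expr0; ring.
(* The surplus [g] exceeds [eps * n] and hence outweighs the loss [z]. *)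
have hw0 : (k - 1 / 2) * n <= N - z by move: hz2 hg; rewrite hN; lra.
have e3 : eps ^+ 3 <= 1 / 8.
  have -> : 1 / 8 = (1 / 2) ^+ 3 :> R by rewrite !exprS expr0; field.
  by rewrite ler_pXn2r // nnegrE; lra.
have hD3 : D <= 27 / 512 * n ^+ 2.
  by apply: (le_trans hD2); rewrite ler_pM2r //; lra.
move: hw hw0; set w := N - z => hw hw0.
(* The left side is at least [7 / 4 * n ^+ 2], but [hw] and [hD3] allow only
   [(1 + 27 / 128) * n ^+ 2] on the right. *)
have : w * (1 / 2 * n) <= w * (w - (k - 1) * n).
  by rewrite ler_wpM2l //; [nra | lra].
have : 7 / 2 * n * n <= w * n by rewrite ler_pM2r //; nra.
move: hw hD3; rewrite !expr2; lra.
Qed.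

(** * Contradiction from the barriers and the block partitions *)

Theorem theorem1 (R : realType) (k : nat) (hk : (4 <= k)%N)
  (eps delta : R) (heps0 : 0 < eps) (heps1 : eps <= 1 / 2)
  (hdelta0 : 0 <= delta) (hdelta1 : delta < eps ^+ 3 / (3 * k%:R ^+ 2))
  (n : nat) (hn : (4 <= n)%N) (hneven : ~~ odd n)
  (G : sgraph) (c : coloring k G)
  (hv : #|G|%:R > (k%:R - 1 / 2 + eps) * n%:R)
  (he : #|edges G|%:R >= (1 - delta) * 'C(#|G|, 2)%:R) :
  has_mono_connected_matching c n./2.
Proof.
have [/existsP[i /existsP[M /andP[MH /eqP cM]]]|/existsPn none] := boolP
    [exists i, exists M : {set {set color_class c i}},
      connected_matching M && (#|M| == n./2)]; first by exists i, M.
have nomono : ~ has_mono_connected_matching c n./2.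
  by case=> i [M [MH cM]]; have /existsPn/(_ M) := none i; rewrite MH cM eqxx.
set h := n./2; have hE : h.*2 = n.
  by have := odd_double_half n; rewrite (negbTE hneven).
have [S [l struct]] := coloring_structure nomono.
rewrite -/h hE in struct.
pose g : R := #|G|%:R - (k%:R - 1 / 2) * n%:R.
have hN : #|G|%:R = g + (k%:R - 1 / 2) * n%:R by rewrite /g subrK.
have hg : eps * n%:R < g by move: hv; rewrite hN; lra.
have n0 : 0 < n%:R :> R by rewrite ltr0n; apply: leq_trans hn.
have nh : n%:R = 2 * h%:R :> R by rewrite -hE -mul2n natrM.
have k4 : 4 <= k%:R :> R by rewrite (ler_nat R 4).
have k_gt0 : (0 < k)%N by apply: leq_trans hk.
have kE : k.-1%:R = k%:R - 1 :> R by rewrite -subn1 natrB.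
have delta1 : delta * (3 * k%:R ^+ 2) < eps ^+ 3.
  by rewrite -ltr_pdivlMr // mulr_gt0 // exprn_gt0 //; lra.
have hD := codegree_sum_bound he hdelta0.
set D := \sum_(x : G) codegree x in hD.
have D0 : 0 <= D%:R :> R by [].
pose B := [set x : G | eps * n%:R <= (codegree x)%:R].
pose W := ~: ((\bigcup_i S i) :|: B).
have WS i x : x \in W -> x \notin S i.
  rewrite !inE negb_or => /andP[nU _]; apply: contra nU => xS.
  by apply/bigcupP; exists i.
have degE x : (\sum_i color_degree c i x + codegree x = #|G| + k.-1)%N.
  have := degree_codegree x; have := sum_color_degree c x.
  move=> eq_sum <-; rewrite /color_degree eq_sum.
  by rewrite addn1 addSnnS prednK // -addnA addnC.
(* The other colors account for at most [k.-1 * n]. The surplus [eps * n] in the order of [G]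
   cancels the codegree allowed outside [B], leaving more than [n / 2] for color [i]. *)
have degW i x : x \in W -> (h < color_degree c i x)%N.
  move=> xW; have := degE x; rewrite (bigD1 i) //=.
  have : (\sum_(j < k | j != i) color_degree c j x <= k.-1 * n)%N.
    have -> : k.-1 = #|[pred j : 'I_k | j != i]| by rewrite cardC1 card_ord.
    rewrite -sum_nat_const; apply: leq_sum => j _.
    by have [/(_ x (WS j x xW))[]] := struct j.
  have : (codegree x)%:R < eps * n%:R.
    by move: xW; rewrite !inE negb_or -ltNge => /andP[].
  move: (color_degree c i x) (\sum_(_ | _) _)%N (codegree x) => d s m.
  rewrite -(ler_nat R) natrM kE => lem les.
  move/(congr1 (fun m => m%:R : R)); rewrite !natrD kE => e.
  by rewrite -(ltr_nat R); move: hg; rewrite /g; lra.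
have boundW : (h * #|~: W| + \sum_(x in ~: W) \sum_i color_degree c i x <=
    h * #|B| + k * n * #|~: W|)%N.
  rewrite -hE; apply: (exceptional_set_bound (S := S)); last by rewrite setCK.
  move=> i; have [_ _] := struct i; rewrite hE; apply; last first.
    by move=> x; apply: degW.
  by rewrite disjoint_subset; apply/subsetP=> x xW; rewrite inE WS.
have cardW : #|G|%:R - #|~: W|%:R = #|W|%:R :> R.
  by rewrite -(cardsC W) natrD addrK.
have hz : eps * g * #|~: W|%:R <= D%:R.
  apply: (@exceptional_numeric _ k%:R n%:R #|G|%:R g _ _ _ #|B|%:R) => //.
    have : (\sum_(x in B) codegree x <= D)%N.
      by rewrite /D [leqRHS](bigID (mem B)) leq_addr.
    rewrite -(ler_nat R); apply: le_trans.
    rewrite mulr_natl -sumr_const natr_sum; apply: ler_sum => x.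
    by rewrite inE.
  have leD : (#|~: W| * #|G| <=
      \sum_(x in ~: W) \sum_i color_degree c i x + D)%N.
    apply: (@leq_trans
      (\sum_(x in ~: W) (\sum_i color_degree c i x + codegree x))).
      by rewrite -sum_nat_const; apply: leq_sum => x _; rewrite degE leq_addr.
    by rewrite big_split leq_add2l /= /D [leqRHS](bigID (mem (~: W))) leq_addr.
  move: boundW leD; rewrite -!(ler_nat R) !(natrD, natrM) nh.
  move: #|~: W|%:R (_%:R) => z s; lra.
(* A vertex of [W] has closed degree at most [n] in every color and codegree below [n / 2], which
   caps the order of [G] at [(k + 1 / 2) * n]. Without such a vertex this cap is missing, so empty
   [W] is treated apart. *)
have [W0|[x xW]] := set_0Vmem W.
  have eG : #|~: W| = #|G| by rewrite W0 setC0 cardsT.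
  rewrite eG in hz.
  by case: (all_exceptional_false k4 n0 heps0 heps1 delta1 hN hg hD hz).
apply: False_ind.
apply: (few_exceptional_false k4 n0 heps0 heps1 hdelta0 delta1 hN hg _ hD _ hz)
  => //.
  have lek : (#|G| + k.-1 <= k * n + codegree x)%N.
    have -> : (k * n = \sum_(i < k) n)%N by rewrite sum_nat_const card_ord.
    rewrite -(degE x) leq_add2r.
    by apply: leq_sum => i _; have [/(_ x (WS i x xW))[]] := struct i.
  have : (codegree x)%:R < eps * n%:R.
    by move: xW; rewrite !inE negb_or -ltNge => /andP[].
  have : eps * n%:R <= 1 / 2 * n%:R by rewrite ler_pM2r.
  move: lek; rewrite -(ler_nat R) !natrD natrM kE.
  move: k4; lra.
(* The vertices of [W] labelled [a] are all elements of [a], which is itself a block of at most [n]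
   vertices if any vertex has this label. *)
have blocks i a : (#|[set x in W | l i x == a]| <= n)%N.
  have [->|[y]] := set_0Vmem [set x in W | l i x == a]; first by rewrite cards0.
  have [inl _ _] := struct i; rewrite inE => /andP[yW /eqP ya].
  have [_ la _] := inl y (WS i y yW); rewrite ya in la.
  apply: leq_trans la; apply: subset_leq_card; apply/subsetP=> z.
  by rewrite inE => /andP[zW /eqP <-]; have [] := inl z (WS i z zW).
have := partition_cover_bound (Ordinal k_gt0) blocks.
set mis := #|[set p in _ | _]|.
(* Adjacent vertices share a block in the color of their edge, so a pair separated in every color is
   distinct and non-adjacent. *)
have : (mis <= D)%N.
  rewrite /D -card_codegree_pairs; apply: subset_leq_card.
  apply/subsetP=> -[u v]; rewrite inE => /andP[/setXP[/= uW vW] /forallP ne].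
  rewrite inE /=.
  apply/andP; split.
    by apply: contraNneq (ne (Ordinal k_gt0)) => ->.
  apply/negP=> uv; have /negP[] := ne (c [set u; v]).
  have [_ /(_ u v (WS _ u uW) (WS _ v vW)) -> //] := struct (c [set u; v]).
  by rewrite /color_adj uv eqxx.
rewrite -!(ler_nat R) !(natrD, natrM, natrX) kE cardW.
move: (_ ^+ 2) => w2; lra.
Qed.
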